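(* Let $E$ be an atomic vector lattice and let $\varphi\in\Phi_1(\mathcal{U}(E,\mathbb{R}))$. Then there is only a finite set $\{e_1,\ldots,e_n\}$ of mutually disjoint atoms in $E$ such that $\varphi(e_i)\neq0$ for $i=1,\ldots,n$; that is, every set of mutually disjoint atoms of $E$ at each of which $\varphi$ does not vanish is finite.
   Context: A non-zero element $u$ of a vector lattice $E$ is an atom if $0\le x\le|u|$, $0\le y\le|u|$ and $x\wedge y=0$ imply $x=0$ or $y=0$. An Archimedean vector lattice $E$ is atomic if for each $0<x\in E$ there is an atom $u\in E$ with $0<u\le x$. Elements $x,y$ are disjoint if $|x|\wedge|y|=0$. For vector lattices $E,F$, an operator $T\colon E\to F$ (not necessarily linear) is orthogonally additive if $T(x+y)=T(x)+T(y)$ whenever $x,y$ are disjoint, and order bounded if it maps order bounded sets into order bounded sets. $\mathcal{U}(E,F)$ is the set of all orthogonally additive order bounded operators $E\to F$ (abstract Uryson operators), ordered by $S\le T$ iff $S(x)\le T(x)$ for all $x\in E$; it is a Dedekind complete vector lattice when $F$ is Dedekind complete. In an Archimedean vector lattice $G$, an element $\varphi\in G$ is finite if there is $z\in G$ such that for every $x\in G$ there is a number $c_x>0$ with $|x|\wedge n|\varphi|\le c_x z$ for all $n\in\mathbb{N}$. $\Phi_1(G)$ is the set of finite elements of $G$. *)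

(* Defs.v *)
From HB Require Import structures.
From mathcomp Require Import all_boot all_order all_algebra.
From mathcomp Require Import all_classical all_reals.

Set Implicit Arguments.
Unset Strict Implicit.
Unset Printing Implicit Defensive.

Import Order.TTheory GRing.Theory Num.Theory.

Local Open Scope classical_set_scope.
Local Open Scope ring_scope.

(* The lattice operations are fields of the mixin because no structure with
   both Zmodule and Order.Lattice can be added on top of Num.RealDomain
   (Hierarchy-Builder rejects the missing join). *)
HB.mixin Record Lmodule_POrder_isVectLattice (R : realType) V
    of GRing.Lmodule R V & Order.isPOrder ring_display V := {
  vmeet : V -> V -> V;
  vjoin : V -> V -> V;
  vlexI : forall x y z : V, (x <= vmeet y z) = (x <= y) && (x <= z);
  vleUx : forall x y z : V, (vjoin x y <= z) = (x <= z) && (y <= z);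
  vl_lerD2r : forall x y z : V, x <= y -> x + z <= y + z;
  vl_scaler_ge0 : forall (a : R) (x : V), 0 <= a -> 0 <= x -> 0 <= a *: x
}.

#[short(type="vectLatticeType")]
HB.structure Definition VectLattice (R : realType) :=
  { V of GRing.Lmodule R V & Order.isPOrder ring_display V
       & Lmodule_POrder_isVectLattice R V }.

Definition vabs (R : realType) (E : vectLatticeType R) (x : E) : E :=
  vjoin x (- x).

Definition vdisjoint (R : realType) (E : vectLatticeType R) (x y : E) : Prop :=
  vmeet (vabs x) (vabs y) = 0.

Definition archimedean (R : realType) (E : vectLatticeType R) : Prop :=
  forall x y : E, 0 <= x -> (forall n : nat, x *+ n <= y) -> x = 0.

Definition atom (R : realType) (E : vectLatticeType R) (u : E) : Prop :=
  u != 0 /\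
  forall x y : E, 0 <= x -> x <= vabs u -> 0 <= y -> y <= vabs u ->
    vmeet x y = 0 -> x = 0 \/ y = 0.

Definition atomic (R : realType) (E : vectLatticeType R) : Prop :=
  archimedean E /\
  forall x : E, 0 < x -> exists u : E, [/\ atom u, 0 < u & u <= x].

Definition Phi1 (R : realType) (G : vectLatticeType R) : set G :=
  [set phi | exists z : G, forall x : G, exists2 c : R, 0 < c &
     forall n : nat, vmeet (vabs x) (vabs phi *+ n) <= c *: z].
Arguments Phi1 {R} G.

Definition order_bounded_set d (T : porderType d) (A : set T) : Prop :=
  exists a b : T, forall x, A x -> (a <= x)%O /\ (x <= b)%O.

Definition order_bounded d d' (T : porderType d) (T' : porderType d')
    (f : T -> T') : Prop :=
  forall A : set T, order_bounded_set A -> order_bounded_set (f @` A).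

Definition orthogonally_additive (R : realType) (E : vectLatticeType R)
    (V : zmodType) (f : E -> V) : Prop :=
  forall x y : E, vdisjoint x y -> f (x + y) = f x + f y.

Section VectLatticeTheory.
Variables (R : realType) (E : vectLatticeType R).
Implicit Types x y z a b c : E.

Lemma vleUl x y : x <= vjoin x y.
Proof. by have := lexx (vjoin x y); rewrite vleUx => /andP[]. Qed.

Lemma vleUr x y : y <= vjoin x y.
Proof. by have := lexx (vjoin x y); rewrite vleUx => /andP[]. Qed.

Lemma vleIl x y : vmeet x y <= x.
Proof. by have := lexx (vmeet x y); rewrite vlexI => /andP[]. Qed.

Lemma vleIr x y : vmeet x y <= y.
Proof. by have := lexx (vmeet x y); rewrite vlexI => /andP[]. Qed.

Lemma vjoinC x y : vjoin x y = vjoin y x.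
Proof. by apply/le_anti; rewrite !vleUx !vleUl !vleUr. Qed.

Lemma vmeetC x y : vmeet x y = vmeet y x.
Proof. by apply/le_anti; rewrite !vlexI !vleIl !vleIr. Qed.

Lemma vmeet_l x y : x <= y -> vmeet x y = x.
Proof. by move=> xy; apply/le_anti; rewrite vleIl vlexI lexx. Qed.

Lemma vmeet_r x y : y <= x -> vmeet x y = y.
Proof. by move=> yx; rewrite vmeetC vmeet_l. Qed.

Lemma vjoin_l x y : y <= x -> vjoin x y = x.
Proof. by move=> yx; apply/le_anti; rewrite vleUl vleUx lexx yx. Qed.

Lemma vleI2 x y z t : x <= z -> y <= t -> vmeet x y <= vmeet z t.
Proof.
by move=> xz yt; rewrite vlexI (le_trans (vleIl _ _)) ?(le_trans (vleIr _ _)).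
Qed.

Lemma vlerD2r z x y : (x + z <= y + z) = (x <= y).
Proof.
apply/idP/idP => [h|]; last exact: vl_lerD2r.
by have := vl_lerD2r _ _ (- z) h; rewrite !addrK.
Qed.

Lemma vlerD2l z x y : (z + x <= z + y) = (x <= y).
Proof. by rewrite ![z + _]addrC vlerD2r. Qed.

Lemma vlerD x y z t : x <= y -> z <= t -> x + z <= y + t.
Proof. by move=> h k; apply: (@le_trans _ _ (y + z)); rewrite ?vlerD2r ?vlerD2l. Qed.

Lemma vaddr_ge0 x y : 0 <= x -> 0 <= y -> 0 <= x + y.
Proof. by move=> h k; rewrite -[0]addr0 vlerD. Qed.

Lemma vlerN2 x y : (- x <= - y) = (y <= x).
Proof.
by rewrite -(vlerD2r (x + y) (- x)) addKr addrCA addNr addr0.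
Qed.

Lemma vsubr_ge0 x y : (0 <= x - y) = (y <= x).
Proof. by rewrite -(vlerD2r y 0) add0r subrK. Qed.

Lemma vlerBlDr x y z : (x - y <= z) = (x <= z + y).
Proof. by rewrite -(vlerD2r y (x - y)) subrK. Qed.

Lemma vlerBrDr x y z : (x <= y - z) = (x + z <= y).
Proof. by rewrite -(vlerD2r z x) subrK. Qed.

Lemma vjoinD x y z : vjoin (x + z) (y + z) = vjoin x y + z.
Proof.
apply/le_anti/andP; split; first by rewrite vleUx !vlerD2r vleUl vleUr.
by rewrite -vlerBrDr vleUx !vlerBrDr vleUl vleUr.
Qed.

Lemma vmeetD x y z : vmeet (x + z) (y + z) = vmeet x y + z.
Proof.
apply/le_anti/andP; split; last by rewrite vlexI !vlerD2r vleIl vleIr.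
by rewrite -vlerBlDr vlexI !vlerBlDr vleIl vleIr.
Qed.

Lemma vjoinN x y : vjoin (- x) (- y) = - vmeet x y.
Proof.
apply/le_anti/andP; split; first by rewrite vleUx !vlerN2 vleIl vleIr.
by rewrite -vlerN2 opprK vlexI -(vlerN2 x) -(vlerN2 y) !opprK vleUl vleUr.
Qed.

Lemma vmeetN x y : vmeet (- x) (- y) = - vjoin x y.
Proof. by rewrite -[vmeet _ _]opprK -vjoinN !opprK. Qed.

Lemma vjoinDmeet x y : vjoin x y + vmeet x y = x + y.
Proof.
have -> : vjoin x y = x + y - vmeet x y.
  rewrite -vjoinN [x + y + _]addrC -vjoinD addKr addrCA addNr addr0.
  exact: vjoinC.
by rewrite subrK.
Qed.

Definition vpos x := vjoin x 0.
Definition vneg x := vjoin (- x) 0.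

Lemma vpos_ge0 x : 0 <= vpos x. Proof. exact: vleUr. Qed.
Lemma vneg_ge0 x : 0 <= vneg x. Proof. exact: vleUr. Qed.

Lemma vposBneg x : vpos x - vneg x = x.
Proof. by rewrite /vpos /vneg -{2}[0]oppr0 vjoinN opprK vjoinDmeet addr0. Qed.

Lemma vle_abs x : x <= vabs x. Proof. exact: vleUl. Qed.
Lemma vleN_abs x : - x <= vabs x. Proof. exact: vleUr. Qed.

Lemma vabs_le x y : (vabs x <= y) = (x <= y) && (- x <= y).
Proof. exact: vleUx. Qed.

Lemma vabsN x : vabs (- x) = vabs x.
Proof. by rewrite /vabs opprK vjoinC. Qed.

Lemma vdouble_ge0 x : 0 <= x + x -> 0 <= x.
Proof.
move=> h; have h2 : (0 : R) <= 2^-1 by rewrite invr_ge0 ler0n.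
have := vl_scaler_ge0 _ _ h2 h.
by rewrite -mulr2n -scaler_nat scalerA mulVf ?scale1r // pnatr_eq0.
Qed.

Lemma vabs_ge0 x : 0 <= vabs x.
Proof. by apply: vdouble_ge0; rewrite -(subrr x) vlerD ?vle_abs ?vleN_abs. Qed.

Lemma vabs_pos x : 0 <= x -> vabs x = x.
Proof.
move=> h; apply/vjoin_l; apply: (@le_trans _ _ 0) => //.
by rewrite -oppr0 vlerN2.
Qed.

Lemma vpos_le_abs x : vpos x <= vabs x.
Proof. by rewrite vleUx vle_abs vabs_ge0. Qed.

Lemma vneg_le_abs x : vneg x <= vabs x.
Proof. by rewrite vleUx vleN_abs vabs_ge0. Qed.

Lemma vabsD_le x y : vabs (x + y) <= vabs x + vabs y.
Proof. by rewrite vabs_le opprD !vlerD ?vle_abs ?vleN_abs. Qed.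

Lemma vabs0 : vabs (0 : E) = 0. Proof. by rewrite vabs_pos. Qed.

Lemma vdisjointC x y : vdisjoint x y -> vdisjoint y x.
Proof. by rewrite /vdisjoint vmeetC. Qed.

Lemma vdisjoint0 x : vdisjoint x 0.
Proof. by rewrite /vdisjoint vabs0; apply/vmeet_r/vabs_ge0. Qed.

Lemma vdisjoint_le x y z t :
  vabs z <= vabs x -> vabs t <= vabs y -> vdisjoint x y -> vdisjoint z t.
Proof.
move=> zx ty xy; apply/le_anti; rewrite vlexI !vabs_ge0 !andbT -xy.
exact: vleI2.
Qed.

Lemma vle_meetD w a x y :
  (w <= a + vmeet x y) = (w <= a + x) && (w <= a + y).
Proof. by rewrite addrC -vlerBlDr vlexI !vlerBlDr ![_ + a]addrC. Qed.

Lemma vmeetDr_le x y z : 0 <= x -> 0 <= y -> 0 <= z ->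
  vmeet z (x + y) <= vmeet z x + vmeet z y.
Proof.
move=> x0 y0 z0; have wz : vmeet z (x + y) <= z by exact: vleIl.
have zD t : 0 <= t -> vmeet z (x + y) <= z + t.
  by move=> t0; rewrite -[leLHS]addr0 vlerD.
rewrite vle_meetD ![vmeet z x + _]addrC !vle_meetD !zD //=.
by rewrite [y + z]addrC [y + x]addrC zD // vleIr.
Qed.

Lemma vmeetDr x y z : 0 <= x -> 0 <= y -> 0 <= z -> vmeet x y = 0 ->
  vmeet z (x + y) = vmeet z x + vmeet z y.
Proof.
move=> x0 y0 z0 xy; apply/le_anti; rewrite vmeetDr_le //=.
have zz : vmeet (vmeet z x) (vmeet z y) = 0.
  by apply/le_anti; rewrite -{1}xy vleI2 ?vleIr // !vlexI x0 y0 z0.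
rewrite -vjoinDmeet zz addr0 vleUx; apply/andP; split; apply: vleI2 => //.
  by rewrite -{1}[x]addr0 vlerD2l.
by rewrite -{1}[y]add0r vlerD2r.
Qed.

Lemma vdisjointD x y z : vdisjoint x z -> vdisjoint y z -> vdisjoint (x + y) z.
Proof.
move=> xz yz; apply/le_anti; rewrite vlexI !vabs_ge0 !andbT.
apply: (@le_trans _ _ (vmeet (vabs z) (vabs x + vabs y))).
  by rewrite vmeetC vleI2 // vabsD_le.
apply: (le_trans (vmeetDr_le _ _ _)); rewrite ?vabs_ge0 //.
by rewrite vmeetC xz vmeetC yz addr0.
Qed.

Lemma vdisjoint_pos x y : vdisjoint x y -> vmeet (vpos x) (vpos y) = 0.
Proof.
move=> xy; apply/le_anti; rewrite vlexI !vpos_ge0 !andbT -xy.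
by apply: vleI2; exact: vpos_le_abs.
Qed.

Lemma vdisjoint_neg x y : vdisjoint x y -> vmeet (vneg x) (vneg y) = 0.
Proof.
move=> xy; apply/le_anti; rewrite vlexI !vneg_ge0 !andbT -xy.
by apply: vleI2; exact: vneg_le_abs.
Qed.

Lemma vposD_neg x : x + vneg x = vpos x.
Proof. by rewrite -{1}(vposBneg x) subrK. Qed.

Lemma vpos_neg0 x : vmeet (vpos x) (vneg x) = 0.
Proof.
rewrite -vposD_neg -{2}[vneg x]add0r vmeetD.
by rewrite /vneg -{2}[0]oppr0 vjoinN subrr.
Qed.

Lemma vabsE x : vabs x = vpos x + vneg x.
Proof.
apply/le_anti/andP; split.
  rewrite -{1}(vposBneg x); apply: (le_trans (vabsD_le _ _)).
  by rewrite vabsN !vabs_pos ?vpos_ge0 ?vneg_ge0.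
by rewrite -vjoinDmeet vpos_neg0 addr0 vleUx vpos_le_abs vneg_le_abs.
Qed.

Lemma vposB x y : vmeet x y = 0 -> vpos (x - y) = x.
Proof.
move=> xy; rewrite /vpos -{1}(subrr y) vjoinD -[vjoin x y]addr0 -xy.
by rewrite vjoinDmeet addrK.
Qed.

Lemma vnegB x y : vmeet x y = 0 -> vneg (x - y) = y.
Proof. by move=> xy; rewrite /vneg opprB -/(vpos _) vposB // vmeetC. Qed.

Lemma vmeetD0 x y z : 0 <= x -> 0 <= y -> 0 <= z ->
  vmeet x z = 0 -> vmeet y z = 0 -> vmeet (x + y) z = 0.
Proof.
move=> x0 y0 z0 xz yz; apply/le_anti; rewrite vlexI z0 vaddr_ge0 // andbT.
rewrite vmeetC (le_trans (vmeetDr_le _ _ _)) //.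
by rewrite [vmeet z x]vmeetC xz vmeetC yz addr0.
Qed.

Lemma vpos_neg_disjoint x y : vdisjoint x y -> vmeet (vpos x) (vneg y) = 0.
Proof.
move=> xy; apply/le_anti; rewrite vlexI vpos_ge0 vneg_ge0 !andbT -xy.
by apply: vleI2; [exact: vpos_le_abs|exact: vneg_le_abs].
Qed.

Lemma vposneg_addI x y : vdisjoint x y ->
  vmeet (vpos x + vpos y) (vneg x + vneg y) = 0.
Proof.
move=> xy; have yx := vdisjointC xy.
apply: vmeetD0; rewrite ?vaddr_ge0 ?vpos_ge0 ?vneg_ge0 //; rewrite vmeetC;
  apply: vmeetD0; rewrite ?vpos_ge0 ?vneg_ge0 // vmeetC;
  by [exact: vpos_neg0|exact: vpos_neg_disjoint].
Qed.

Lemma vposneg_add x y :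
  x + y = (vpos x + vpos y) - (vneg x + vneg y).
Proof. by rewrite opprD addrACA !vposBneg. Qed.

Lemma vposD x y : vdisjoint x y -> vpos (x + y) = vpos x + vpos y.
Proof. by move=> xy; rewrite vposneg_add vposB // vposneg_addI. Qed.

Lemma vnegD x y : vdisjoint x y -> vneg (x + y) = vneg x + vneg y.
Proof. by move=> xy; rewrite vposneg_add vnegB // vposneg_addI. Qed.

Definition fragment y x : Prop := vdisjoint y (x - y).

Lemma fragment0 x : fragment 0 x.
Proof. by apply: vdisjointC; exact: vdisjoint0. Qed.

Lemma fragment_refl x : fragment x x.
Proof. by rewrite /fragment subrr; exact: vdisjoint0. Qed.

Lemma fragment_compl y x : fragment y x -> fragment (x - y) x.
Proof. by rewrite /fragment subKr; exact: vdisjointC. Qed.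

Lemma fragment_abs y x : fragment y x -> vabs y <= vabs x.
Proof.
move=> yx; have -> : vabs x = vabs (y + (x - y)) by rewrite subrKC.
rewrite !vabsE vposD // vnegD //.
apply: vlerD; rewrite -[leLHS]addr0 vlerD2l.
  exact: vpos_ge0.
exact: vneg_ge0.
Qed.

Lemma fragmentD y1 x1 y2 x2 : vdisjoint x1 x2 ->
  fragment y1 x1 -> fragment y2 x2 ->
  fragment (y1 + y2) (x1 + x2) /\ vdisjoint y1 y2.
Proof.
move=> xx f1 f2; have le1 := fragment_abs f1; have le2 := fragment_abs f2.
have ge1 := fragment_abs (fragment_compl f1).
have ge2 := fragment_abs (fragment_compl f2).
split; last exact: vdisjoint_le xx.
rewrite /fragment opprD addrACA; apply: vdisjointD; apply: vdisjointC.
  apply: vdisjointD; first exact: vdisjointC.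
  by apply: vdisjoint_le (vdisjointC xx).
apply: vdisjointD; last exact: vdisjointC.
by apply: vdisjoint_le xx.
Qed.

(* The component of y along x; if y is a fragment of x + x' with x and x'
   disjoint, then y = vpart y x + vpart y x'. *)
Definition vpart y x : E :=
  vmeet (vpos y) (vpos x) - vmeet (vneg y) (vneg x).

Lemma vpart_abs y x : vabs (vpart y x) <= vabs y.
Proof.
apply: (le_trans (vabsD_le _ _)); rewrite vabsN (vabsE y).
rewrite (vabs_pos (x := vmeet (vpos _) _)) ?vlexI ?vpos_ge0 //.
rewrite (vabs_pos (x := vmeet (vneg _) _)) ?vlexI ?vneg_ge0 //.
by apply: vlerD; exact: vleIl.
Qed.

Lemma vpartDr y x1 x2 : vdisjoint x1 x2 -> fragment y (x1 + x2) ->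
  y = vpart y x1 + vpart y x2.
Proof.
move=> xx yx; rewrite -{1}(vposBneg y) /vpart addrACA -opprD.
rewrite -!vmeetDr ?vpos_ge0 ?vneg_ge0 ?vdisjoint_neg ?vdisjoint_pos //.
rewrite -vposD // -vnegD // -(subrKC y (x1 + x2)) vposD // vnegD //.
rewrite !vmeet_l //; rewrite -[leLHS]addr0 vlerD2l;
  by [exact: vneg_ge0|exact: vpos_ge0].
Qed.

Lemma vpart_sym y x : vpart y x = vpart x y.
Proof. by rewrite /vpart vmeetC [vmeet (vneg _) _]vmeetC. Qed.

Lemma fragmentD_split y x1 x2 : vdisjoint x1 x2 -> fragment y (x1 + x2) ->
  exists y1 y2, [/\ fragment y1 x1, fragment y2 x2 & y = y1 + y2].
Proof.
move=> xx yx; exists (vpart y x1), (vpart y x2).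
suff H a b : vdisjoint a b -> fragment y (a + b) -> fragment (vpart y a) a.
  split; [exact: H xx yx| |exact: vpartDr].
  by apply: H (vdisjointC xx) _; rewrite addrC.
move=> ab yab; rewrite /fragment.
have aE : a - vpart y a = vpart (a + b - y) a.
  apply/eqP; rewrite subr_eq addrC; apply/eqP.
  rewrite [vpart y a]vpart_sym [vpart _ a]vpart_sym.
  apply: vpartDr => //; rewrite subrKC /fragment addrC addKr.
  exact: ab.
by rewrite aE; apply: vdisjoint_le yab; exact: vpart_abs.
Qed.

Lemma vabs_itv a b x : a <= x -> x <= b -> vabs x <= vabs a + vabs b.
Proof.
move=> ax xb; rewrite vabs_le -{1}[x]add0r vlerD ?vabs_ge0 //=; last first.
  exact: le_trans (vle_abs _).
rewrite -[- x]addr0 vlerD ?vabs_ge0 //.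
by apply: le_trans (vleN_abs a); rewrite vlerN2.
Qed.

Lemma vabs_leP x c : vabs x <= c -> - c <= x /\ x <= c.
Proof.
rewrite vabs_le => /andP[xc Nxc]; split=> //.
by rewrite -vlerN2 opprK.
Qed.

End VectLatticeTheory.

Section Uryson.
Variables (R : realType) (E : vectLatticeType R).
Implicit Types f g : E -> R^o.

(* R^o is R regarded as a module over itself, so that E -> R^o carries the
   pointwise module structure that uryson E inherits. *)
Definition is_uryson f : Prop :=
  orthogonally_additive f /\ order_bounded (f : E -> R).

Definition uryson_pred : {pred E -> R^o} := [pred f | `[< is_uryson f >]].

Lemma uryson_predP f : reflect (is_uryson f) (f \in uryson_pred).
Proof. exact: asboolP. Qed.

Lemma order_boundedP f : order_bounded (f : E -> R) <->
  forall c : E, exists M : R, forall x, vabs x <= c -> `|f x : R| <= M.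
Proof.
split=> [fb c|fb A [a [b Aab]]].
  have [|u [v uv]] := fb [set x | vabs x <= c].
    by exists (- c), c => x /vabs_leP.
  exists (`|u| + `|v|) => x xc; have [ux xv] := uv (f x) (imageP f xc).
  rewrite ler_norml (le_trans xv) ?andbT; last first.
    by rewrite (le_trans (ler_norm v)) // lerDr.
  rewrite (le_trans _ ux) // opprD lerBlDr (@le_trans _ _ u) //.
    by rewrite lerNl -normrN ler_norm.
  by rewrite lerDl.
have [M fM] := fb (vabs a + vabs b).
exists (- M), M => _ [x Ax <-]; have [ax xb] := Aab _ Ax.
by have := fM x (vabs_itv ax xb); rewrite ler_norml => /andP.
Qed.

Lemma uryson_submod_closed : submod_closed uryson_pred.
Proof.
split.
  apply/uryson_predP; split=> [x y _|]; first by rewrite addr0.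
  by apply/order_boundedP => c; exists 0 => x _; rewrite normr0.
move=> a f g /uryson_predP[fo /order_boundedP fb].
move=> /uryson_predP[go /order_boundedP gb].
apply/uryson_predP; split=> [x y xy|].
  by rewrite !fctE fo // go // scalerDr addrACA.
apply/order_boundedP => c; have [M fM] := fb c; have [N gN] := gb c.
exists (`|a| * M + N) => x xc; rewrite !fctE (le_trans (ler_normD _ _)) //.
by rewrite lerD ?gN // normrM ler_wpM2l ?fM.
Qed.

HB.instance Definition _ :=
  GRing.isSubmodClosed.Build R (E -> R^o) uryson_pred uryson_submod_closed.

End Uryson.

Record uryson (R : realType) (E : vectLatticeType R) := Uryson {
  uryson_fun :> E -> R^o;
  _ : uryson_fun \in @uryson_pred R E
}.

HB.instance Definition _ (R : realType) (E : vectLatticeType R) :=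
  [isSub for @uryson_fun R E].
HB.instance Definition _ (R : realType) (E : vectLatticeType R) :=
  [Choice of uryson E by <:].
HB.instance Definition _ (R : realType) (E : vectLatticeType R) :=
  [SubChoice_isSubLmodule of uryson E by <:].

Section UrysonOrder.
Variables (R : realType) (E : vectLatticeType R).
Implicit Types S T : uryson E.

Lemma uryson_ext S T : S =1 T -> S = T.
Proof. by move=> ST; apply/val_inj/funext. Qed.

Lemma urysonD S T x : (S + T) x = S x + T x. Proof. by []. Qed.
Lemma urysonN S x : (- S) x = - S x. Proof. by []. Qed.
Lemma urysonZ (a : R) S x : (a *: S) x = a * S x. Proof. by []. Qed.
Lemma uryson0E x : (0 : uryson E) x = 0. Proof. by []. Qed.

Lemma uryson_oadd T : orthogonally_additive T.
Proof. by case: T => f /= /uryson_predP[]. Qed.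

Lemma uryson_obounded T : order_bounded (T : E -> R).
Proof. by case: T => f /= /uryson_predP[]. Qed.

Definition uryson_le S T : bool := `[< forall x : E, (S x : R) <= T x >].

Lemma uryson_le_refl : reflexive uryson_le.
Proof. by move=> S; apply/asboolP. Qed.

Lemma uryson_le_anti : antisymmetric uryson_le.
Proof.
move=> S T /andP[/asboolP ST /asboolP TS]; apply: uryson_ext => x.
by apply: (@le_anti _ R); rewrite ST TS.
Qed.

Lemma uryson_le_trans : transitive uryson_le.
Proof.
move=> S T U /asboolP ST /asboolP TU; apply/asboolP => x.
exact: le_trans (ST x) (TU x).
Qed.

End UrysonOrder.

HB.instance Definition _ (R : realType) (E : vectLatticeType R) :=
  Order.Le_isPOrder.Build ring_display (uryson E)
    (@uryson_le_refl R E) (@uryson_le_anti R E) (@uryson_le_trans R E).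

Section UrysonLattice.
Variables (R : realType) (E : vectLatticeType R).
Implicit Types S T : uryson E.

Lemma uryson_leP S T : reflect (forall x : E, (S x : R) <= T x) (S <= T).
Proof. exact: asboolP. Qed.

Lemma uryson_at0 T : T 0 = 0.
Proof.
have := uryson_oadd T (vdisjoint0 (0 : E)).
by rewrite addr0 -{1}[T 0]addr0 => /addrI.
Qed.

(* The positive part of T in the pointwise order is not the pointwise positive
   part: T^+ x is the supremum of T y over the fragments y of x. *)
Definition frag_img T (x : E) : set R := [set (T y : R) | y in [set y | fragment y x]].

Definition uryson_pos_fun T : E -> R^o := fun x => sup (frag_img T x).

Lemma frag_img_has_sup T x : has_sup (frag_img T x).
Proof.
split; first by exists (T 0), 0 => //; exact: fragment0.
have /order_boundedP/(_ (vabs x))[M TM] := uryson_obounded T.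
exists M => _ [y /fragment_abs yx <-].
exact: le_trans (ler_norm _) (TM _ yx).
Qed.

Lemma uryson_pos_ub T x y : fragment y x -> (T y : R) <= uryson_pos_fun T x.
Proof.
by move=> yx; apply: (sup_upper_bound (frag_img_has_sup T x)); exists y.
Qed.

Lemma uryson_pos_le T x (M : R) :
  (forall y, fragment y x -> (T y : R) <= M) -> (uryson_pos_fun T x : R) <= M.
Proof.
move=> TM; apply: ge_sup; first exact: (frag_img_has_sup T x).1.
by move=> _ [y yx <-]; exact: TM.
Qed.

Lemma uryson_pos_subproof T : uryson_pos_fun T \in @uryson_pred R E.
Proof.
apply/uryson_predP; split=> [x y xy|].
  apply: (@le_anti _ R); apply/andP; split.
    apply: uryson_pos_le => z zxy.
    have [z1 [z2 [f1 f2 ->]]] := fragmentD_split xy zxy.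
    have [_ d] := fragmentD xy f1 f2.
    by rewrite (uryson_oadd T d) lerD // uryson_pos_ub.
  rewrite -lerBrDr; apply: uryson_pos_le => z1 f1; rewrite lerBrDr addrC.
  rewrite -lerBrDr; apply: uryson_pos_le => z2 f2; rewrite lerBrDr addrC.
  have [f d] := fragmentD xy f1 f2.
  by rewrite -(uryson_oadd T d) uryson_pos_ub.
apply/order_boundedP => c.
have /order_boundedP/(_ c)[M TM] := uryson_obounded T.
exists M => x xc; rewrite ger0_norm.
  apply: uryson_pos_le => y /fragment_abs yx.
  exact: le_trans (ler_norm _) (TM _ (le_trans yx xc)).
by rewrite -(uryson_at0 T) uryson_pos_ub //; exact: fragment0.
Qed.

Definition uryson_pos T : uryson E := Uryson (uryson_pos_subproof T).

Lemma uryson_pos_lub T S : (uryson_pos T <= S) = (T <= S) && (0 <= S).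
Proof.
apply/idP/andP => [/uryson_leP h|[/uryson_leP TS /uryson_leP S0]].
  split; apply/uryson_leP => x; apply: le_trans (h x).
    by apply: uryson_pos_ub; exact: fragment_refl.
  by rewrite uryson0E -(uryson_at0 T); apply: uryson_pos_ub; exact: fragment0.
apply/uryson_leP => x; apply: uryson_pos_le => y yx.
apply: (le_trans (TS y)).
rewrite -[x in leRHS](subrKC y) uryson_oadd // lerDl.
exact: S0.
Qed.

Lemma uryson_lerD2r S T U : S <= T -> S + U <= T + U.
Proof.
move=> /uryson_leP ST; apply/uryson_leP => x.
by rewrite !urysonD; apply: (@lerD R) => //; exact: ST.
Qed.

Lemma uryson_scaler_ge0 (a : R) T : 0 <= a -> 0 <= T -> 0 <= a *: T.
Proof.
move=> a0 /uryson_leP T0; apply/uryson_leP => x.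
by rewrite urysonZ; apply: mulr_ge0 => //; exact: T0.
Qed.

Lemma uryson_lerBlDr S T U : (S - T <= U) = (S <= U + T).
Proof.
apply/idP/idP => [/(uryson_lerD2r T)|/(uryson_lerD2r (- T))].
  by rewrite subrK.
by rewrite addrK.
Qed.

Lemma uryson_lerN2 S T : (- S <= - T) = (T <= S).
Proof.
by rewrite -[- S]add0r uryson_lerBlDr addrC -uryson_lerBlDr opprK add0r.
Qed.

Definition uryson_join S T : uryson E := T + uryson_pos (S - T).
Definition uryson_meet S T : uryson E := - uryson_join (- S) (- T).

Lemma uryson_joinP S T U : (uryson_join S T <= U) = (S <= U) && (T <= U).
Proof.
rewrite /uryson_join addrC -{2}[T]opprK uryson_lerBlDr uryson_pos_lub.
by rewrite uryson_lerBlDr subrK -uryson_lerBlDr sub0r opprK.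
Qed.

Lemma uryson_meetP S T U : (S <= uryson_meet T U) = (S <= T) && (S <= U).
Proof.
by rewrite -uryson_lerN2 opprK uryson_joinP !uryson_lerN2.
Qed.

End UrysonLattice.

HB.instance Definition _ (R : realType) (E : vectLatticeType R) :=
  Lmodule_POrder_isVectLattice.Build R (uryson E)
    (@uryson_meetP R E) (@uryson_joinP R E)
    (@uryson_lerD2r R E) (@uryson_scaler_ge0 R E).

Lemma uryson_archimedean (R : realType) (E : vectLatticeType R) :
  archimedean (uryson E).
Proof.
move=> S T /uryson_leP S0 ST; apply: uryson_ext => x; apply: (@le_anti _ R).
rewrite S0 andbT leNgt; apply/negP => Sx.
set n := Num.bound (T x / S x : R).
have /uryson_leP/(_ x) := ST n.
have -> : (S *+ n) x = n%:R * S x by rewrite -scaler_nat urysonZ.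
rewrite -ler_pdivlMr // leNgt => /negP; apply.
have T0 : 0 <= (T x : R) by have /uryson_leP/(_ x) := ST 0%N.
by apply: archi_boundP; rewrite divr_ge0 // ltW.
Qed.

(* Main.v *)
Require Import Defs.
From mathcomp Require Import all_boot all_order all_algebra.
From mathcomp Require Import all_classical all_reals.
From mathcomp Require Import topology normedtype sequences.
From mathcomp Require Import ring.

Set Implicit Arguments.
Unset Strict Implicit.
Unset Printing Implicit Defensive.

Import Order.TTheory GRing.Theory Num.Theory.
Import numFieldNormedType.Exports.

Local Open Scope classical_set_scope.
Local Open Scope ring_scope.

(** Write [e <| x] for: e is a fragment of x.  An atom e has no fragments but
    0 and e, so the lattice operations of abstract Uryson operators, which
    are suprema over fragments, become pointwise at e: there
    [(T /\ n |phi|) e >= min (T e) (n |phi| e)].  If z witnesses that phi is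
    finite and phi e <> 0, letting n grow yields a constant c, depending on T
    but not on e, with [T e <= c * z e] ([Phi1_atom_majorant]).  So z dominates,
    up to a factor, every Uryson operator T along the atoms at which phi does
    not vanish, and it remains to produce a T that outgrows z along any
    infinite set A of such disjoint atoms.

    Since e is an atom, the 0-1 indicator of [e <| x] is orthogonally additive
    in x ([frag_indD]).  Hence [T x = \sum_k t_k * [e_k <| x]] is a Uryson
    operator with [T e_k >= t_k] for all atoms e_k and weights t_k >= 0, as soon
    as for every b the weights of the e_k with [|e_k| <= b] have bounded partial
    sums ([uryson_atomic_series]).  Two cases show that such weights can always
    be chosen so that t_k / z e_k is unbounded.
    - If z takes arbitrarily small values on A, pick e_k in A with
      [z e_k < 4^-k] and set t_k = 2^-k, which is summable; the e_k may repeat.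
    - If z >= eps > 0 on A, then only finitely many elements of A lie in a given
      order interval: n disjoint ones add up to an element of that interval at
      which z is at least n * eps, while z is order bounded
      ([finite_set_order_bounded]).  So every choice of weights is allowed along
      an injective sequence in A, in particular t_k = k * z e_k. *)

(** * Sums of disjoint elements *)

Section DisjointElements.
Variables (R : realType) (E : vectLatticeType R).
Implicit Types (x y b e : E) (f : nat -> E).

Lemma vabs_eq0 x : vabs x = 0 -> x = 0.
Proof.
move=> x0; apply/le_anti; rewrite -{1}x0 vle_abs /=.
by rewrite -vlerN2 oppr0 -x0 vleN_abs.
Qed.

Lemma vdisjoint_refl_eq0 x : vdisjoint x x -> x = 0.
Proof. by rewrite /vdisjoint vmeet_l // => /vabs_eq0. Qed.

Lemma vabsD_disjoint_le b x y :
  vdisjoint x y -> vabs x <= b -> vabs y <= b -> vabs (x + y) <= b.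
Proof.
move=> xy xb yb; apply: (le_trans (vabsD_le x y)).
by rewrite -vjoinDmeet xy addr0 vleUx xb yb.
Qed.

Lemma vdisjoint_sum n f x : (forall k, (k < n)%N -> vdisjoint (f k) x) ->
  vdisjoint (\sum_(k < n) f k) x.
Proof.
elim: n => [_|n IH fx]; first by rewrite big_ord0; exact/vdisjointC/vdisjoint0.
rewrite big_ord_recr /=; apply: vdisjointD; last exact: fx.
by apply: IH => k kn; apply/fx/ltnW.
Qed.

Lemma vabs_sum_disjoint_le b f n :
  (forall i j, i <> j -> vdisjoint (f i) (f j)) ->
  (forall k, vabs (f k) <= b) -> vabs (\sum_(k < n) f k) <= b.
Proof.
move=> fd fb; elim: n => [|n IH].
  by rewrite big_ord0 vabs0; exact: le_trans (vabs_ge0 (f 0%N)) (fb 0%N).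
rewrite big_ord_recr /=; apply: vabsD_disjoint_le => //.
by apply: vdisjoint_sum => k kn; apply: fd => kE; rewrite kE ltnn in kn.
Qed.

Lemma uryson_sum_disjoint (T : uryson E) f n :
  (forall i j, i <> j -> vdisjoint (f i) (f j)) ->
  T (\sum_(k < n) f k) = \sum_(k < n) T (f k).
Proof.
move=> fd; elim: n => [|n IH]; first by rewrite !big_ord0 uryson_at0.
rewrite !big_ord_recr /= uryson_oadd ?IH //.
by apply: vdisjoint_sum => k kn; apply: fd => kE; rewrite kE ltnn in kn.
Qed.

End DisjointElements.

(** * Indicators of atoms *)

Section AtomIndicator.
Variables (R : realType) (E : vectLatticeType R).
Implicit Types (x y e : E).

Lemma fragment_atom e y : atom e -> fragment y e -> y = 0 \/ y = e.
Proof.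
move=> [_ ea] ye.
have [] := ea (vabs y) (vabs (e - y)); rewrite ?vabs_ge0 ?fragment_abs //.
- exact: fragment_compl.
- by move=> /vabs_eq0; left.
- by move=> /vabs_eq0/eqP; rewrite subr_eq0 => /eqP; right.
Qed.

Definition frag_ind e x : R := (`[< fragment e x >] : bool)%:R.

Lemma frag_ind_ge0 e x : 0 <= frag_ind e x.
Proof. exact: ler0n. Qed.

Lemma frag_indxx e : frag_ind e e = 1.
Proof. by rewrite /frag_ind asboolT //; exact: fragment_refl. Qed.

(** If e is a fragment of x + y, it splits into disjoint fragments of x and of
    y, and one of these two pieces is all of e; it cannot be a fragment of both
    x and y, since it would then be disjoint from itself. *)
Lemma frag_indD e x y : atom e -> vdisjoint x y ->
  frag_ind e (x + y) = frag_ind e x + frag_ind e y.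
Proof.
move=> ea xy; rewrite /frag_ind.
have inl a b : vdisjoint a b -> fragment e a -> fragment e (a + b).
  by move=> ab ea'; have [] := fragmentD ab ea' (fragment0 b); rewrite addr0.
case: (asboolP (fragment e x)) => ex; case: (asboolP (fragment e y)) => ey.
- have [_ /vdisjoint_refl_eq0 e0] := fragmentD xy ex ey.
  by case: ea; rewrite e0 eqxx.
- by rewrite asboolT ?addr0 //; exact: inl.
- by rewrite asboolT ?add0r // addrC; apply: inl (vdisjointC xy) _.
rewrite asboolF ?addr0 // => /(fragmentD_split xy)[y1 [y2 [f1 f2 eE]]].
have y1e : fragment y1 e.
  rewrite /fragment eE addrC addKr.
  by have [_] := fragmentD xy f1 f2.
have [y10|y1E] := fragment_atom ea y1e; last by apply: ex; rewrite -y1E.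
by apply: ey; rewrite eE y10 add0r.
Qed.

End AtomIndicator.

(** * Series of indicators *)

(** The partial sums are nondecreasing and stay constant once they have passed
    the largest index that satisfies P, so that value bounds them all. *)
Lemma sum_finite_support_bounded (R : realType) (P : pred nat) (t : nat -> R) :
  (forall k, 0 <= t k) -> finite_set [set k | P k] ->
  exists M : R, forall n, \sum_(k < n | P k) t k <= M.
Proof.
move=> t0 /finite_seqP[s sE]; pose S n : R := \sum_(k < n | P k) t k.
pose N := (\max_(k <- s) k).+1; exists (S N) => n.
have S_nd : {homo S : m p / (m <= p)%N >-> m <= p}.
  apply/nondecreasing_seqP => m; rewrite /S big_mkcond [leRHS]big_mkcond.
  by rewrite big_ord_recr /= lerDl; case: ifP.
have SN m : S (N + m)%N = S N.
  elim: m => [|m IH]; first by rewrite addn0.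
  rewrite addnS -IH /S big_mkcond big_ord_recr -big_mkcond /=.
  case: ifP => [kP|_]; rewrite ?addr0 //.
  have ks : (N + m)%N \in s.
    by have : [set k | P k] (N + m)%N by []; rewrite sE.
  have := leq_bigmax_seq (P := xpredT) (F := id) _ ks isT.
  by rewrite leqNgt ltnS leq_addr.
by rewrite -(SN n) S_nd // leq_addl.
Qed.

Lemma sum_geometric_half_le (R : realType) (P : pred nat) n :
  \sum_(k < n | P k) 2^-1 ^+ k <= 2 :> R.
Proof.
have half_ge0 k : 0 <= 2^-1 ^+ k :> R by rewrite exprn_ge0 ?invr_ge0 ?ler0n.
apply: (@le_trans _ _ (\sum_(k < n) 2^-1 ^+ k)).
  by rewrite big_mkcond /=; apply: ler_sum => k _; case: ifP.
suff -> : \sum_(k < n) 2^-1 ^+ k = 2 - 2 * 2^-1 ^+ n :> R.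
  by rewrite gerBl mulr_ge0.
elim: n => [|n IH]; first by rewrite big_ord0 expr0 mulr1 subrr.
by rewrite big_ord_recr /= IH exprS; field.
Qed.

Section AtomicSeries.
Variables (R : realType) (E : vectLatticeType R).
Variables (e : nat -> E) (t : nat -> R).
Hypothesis e_atom : forall k, atom (e k).
Hypothesis t_ge0 : forall k, 0 <= t k.
Hypothesis t_bound : forall b : E, exists M : R,
  forall n, \sum_(k < n | vabs (e k) <= b) t k <= M.

Let S (x : E) : nat -> R := fun n => \sum_(k < n) t k * frag_ind (e k) x.

Let S_nd x : nondecreasing_seq (S x).
Proof.
apply/nondecreasing_seqP => n; rewrite /S big_ord_recr /= lerDl.
by rewrite mulr_ge0 ?frag_ind_ge0.
Qed.

Let S_le x b n : vabs x <= b ->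
  S x n <= \sum_(k < n | vabs (e k) <= b) t k.
Proof.
move=> xb; rewrite /S [leRHS]big_mkcond; apply: ler_sum => k _.
rewrite /frag_ind; case: asboolP => [ex|_]; last by rewrite mulr0; case: ifP.
by rewrite mulr1 (le_trans (fragment_abs ex) xb).
Qed.

Let S_cvg x : cvgn (S x).
Proof.
apply: nondecreasing_is_cvgn => //.
have [M tM] := t_bound (vabs x); exists M => _ [n _ <-].
exact: le_trans (S_le n (lexx _)) (tM n).
Qed.

(** The partial sums at x only count the e_k that are fragments of x, and these
    satisfy [|e_k| <= |x|]; so the hypothesis on the weights gives both the
    convergence of the series and its order boundedness. *)
Lemma uryson_atomic_series : exists T : uryson E, forall k, t k <= T (e k).
Proof.
pose T : E -> R^o := fun x => limn (S x).
suff TU : T \in @uryson_pred R E.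
  exists (Uryson TU) => k /=.
  apply: le_trans (nondecreasing_cvgn_le (@S_nd (e k)) (@S_cvg (e k)) k.+1).
  rewrite /S big_ord_recr /= frag_indxx mulr1 lerDr.
  by apply: sumr_ge0 => i _; rewrite mulr_ge0 ?frag_ind_ge0.
apply/uryson_predP; split=> [x y xy|].
  rewrite /T -(limD (@S_cvg x) (@S_cvg y)); congr (limn _).
  apply/funext => n; rewrite /S fctE -big_split /=; apply: eq_bigr => k _.
  by rewrite frag_indD // mulrDr.
apply/order_boundedP => b; have [M tM] := t_bound b; exists M => x xb.
rewrite ger0_norm; last first.
  apply: limr_ge; first exact: S_cvg.
  by apply: nearW => n; apply: sumr_ge0 => i _; rewrite mulr_ge0 ?frag_ind_ge0.
apply: limr_le; first exact: S_cvg.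
by apply: nearW => n; exact: le_trans (S_le n xb) (tM n).
Qed.

End AtomicSeries.

(** * Finite elements evaluated at atoms *)

Section FiniteElements.
Variables (R : realType) (E : vectLatticeType R).
Implicit Types (S T U phi z : uryson E) (e : E).

Lemma uryson_pos_atom_le e T : atom e ->
  (uryson_pos_fun T e : R) <= Num.max 0 (T e : R).
Proof.
move=> ea; apply: uryson_pos_le => y /(fragment_atom ea)[->|->].
  by rewrite uryson_at0 le_max lexx.
by rewrite le_max lexx orbT.
Qed.

(** The meet is [T - (T - S)^+], whose value at e is governed by the only two
    fragments 0 and e of the atom. *)
Lemma uryson_meet_atom_ge e S T : atom e ->
  Num.min (S e : R) (T e : R) <= vmeet S T e.
Proof.
move=> ea; change (vmeet S T) with (uryson_meet S T).
rewrite /uryson_meet /uryson_join urysonN urysonD urysonN opprD opprK.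
apply: le_trans (lerB (lexx (T e : R)) (uryson_pos_atom_le _ ea)).
rewrite urysonD !urysonN opprK [- (S e : R) + _]addrC.
have [ST|/ltW TS] := leP (S e : R) (T e : R).
  by rewrite max_r ?subr_ge0 // subKr.
by rewrite max_l ?subr_le0 // subr0.
Qed.

Lemma uryson_abs_ge phi e : `|phi e : R| <= vabs phi e.
Proof.
rewrite ler_norml lerNl.
have /uryson_leP -> := vle_abs phi; have /uryson_leP/(_ e) := vleN_abs phi.
by rewrite urysonN => ->.
Qed.

(** For each e the integer n can be taken so large that the meet with
    [n |phi|] no longer truncates T at e, whereas the bound c * z is uniform
    in n. *)
Lemma Phi1_atom_majorant phi : Phi1 (uryson E) phi ->
  exists z : uryson E, forall T, exists2 c : R, 0 < c &
    forall e, atom e -> phi e != 0 -> (T e : R) <= c * z e.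
Proof.
move=> [z zP]; exists z => T; have [c c0 cP] := zP T; exists c => // e ea pe.
have p0 : 0 < vabs phi e.
  by apply: lt_le_trans (uryson_abs_ge phi e); rewrite normr_gt0.
pose n := Num.bound (`|T e / vabs phi e| : R).
have /uryson_leP/(_ e) := cP n; rewrite urysonZ; apply: le_trans.
apply: le_trans (uryson_meet_atom_ge _ _ ea); rewrite le_min.
have /uryson_leP -> /= := vle_abs T.
rewrite -scaler_nat urysonZ -ler_pdivrMr //.
apply: le_trans (ler_norm _) (ltW _).
by apply: archi_boundP; exact: normr_ge0.
Qed.

Lemma atom_majorant_gt0 phi z :
  (forall T, exists2 c : R, 0 < c &
    forall e, atom e -> phi e != 0 -> (T e : R) <= c * z e) ->
  forall e, atom e -> phi e != 0 -> 0 < (z e : R).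
Proof.
move=> zP e ea pe; have [c c0 cP] := zP (vabs phi).
rewrite -(pmulr_rgt0 _ c0); apply: lt_le_trans (cP e ea pe).
by apply: lt_le_trans (uryson_abs_ge phi e); rewrite normr_gt0.
Qed.

End FiniteElements.

(** * Disjoint sets of atoms *)

Lemma infinite_set_seq (T : Type) (A : set T) : infinite_set A ->
  exists f : nat -> T, injective f /\ forall n, A (f n).
Proof.
elim/Ppointed: T => T in A *; first by rewrite emptyE => /infinite_setN0[].
move=> /infiniteP/pcard_leP[f]; exists f; split; first exact: injT.
by move=> n; exact: funS.
Qed.

(** Disjoint elements below b in modulus have sums below b in modulus, so z is
    bounded on these sums, while each summand contributes at least eps. *)
Lemma finite_set_order_bounded (R : realType) (E : vectLatticeType R)
    (z : uryson E) (B : set E) (b : E) (eps : R) :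
  0 < eps -> (forall x, B x -> eps <= z x) ->
  (forall x y, B x -> B y -> x <> y -> vdisjoint x y) ->
  finite_set (B `&` [set x | vabs x <= b]).
Proof.
move=> eps0 Bz Bd; apply: contrapT => /infinite_set_seq[f [finj fB]].
have fd i j : i <> j -> vdisjoint (f i) (f j).
  move=> ij; have [[Bi _] [Bj _]] := (fB i, fB j); apply: Bd => // fij.
  by apply: ij; exact: finj.
have /order_boundedP/(_ b)[M zM] := uryson_obounded z.
have nM n : n%:R * eps <= M.
  have fb : vabs (\sum_(k < n) f k) <= b.
    by apply: vabs_sum_disjoint_le => // k; have [] := fB k.
  apply: le_trans (zM _ fb); apply: le_trans (ler_norm _).
  rewrite uryson_sum_disjoint // mulr_natl -[n in leLHS]card_ord -sumr_const.
  by apply: ler_sum => k _; apply: Bz; have [] := fB k.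
have M0 : 0 <= M by have := nM 0%N; rewrite mul0r.
have := nM (Num.bound (M / eps)); rewrite -ler_pdivlMr // leNgt => /negP; apply.
by apply: archi_boundP; rewrite divr_ge0 // ltW.
Qed.

Theorem theorem4p5 (R : realType) (E : vectLatticeType R) (hE : atomic E)
    (phi : uryson E) (hphi : Phi1 (uryson E) phi)
    (A : set E)
    (hatom : forall e : E, A e -> atom e)
    (hdisj : forall e f : E, A e -> A f -> e <> f -> vdisjoint e f)
    (hne : forall e : E, A e -> phi e != 0) :
  finite_set A.
Proof.
have [z zP] := Phi1_atom_majorant hphi.
have z_gt0 e : A e -> 0 < (z e : R).
  by move=> Ae; apply: (atom_majorant_gt0 zP); [exact: hatom|exact: hne].
(* Weights admissible for a series of indicators cannot outgrow z. *)
have bound (e : nat -> E) (t : nat -> R) : (forall k, A (e k)) ->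
    (forall k, 0 <= t k) ->
    (forall b : E, exists M : R,
      forall n, \sum_(k < n | vabs (e k) <= b) t k <= M) ->
    exists2 c : R, 0 < c & forall k, t k <= c * z (e k).
  move=> eA t0 tM.
  have [T tT] := uryson_atomic_series (fun k => hatom _ (eA k)) t0 tM.
  have [c c0 cP] := zP T; exists c => // k; apply: le_trans (tT k) _.
  by apply: cP; [exact: hatom|exact: hne].
have [[eps eps0 epsz]|noeps] :=
    pselect (exists2 eps : R, 0 < eps & forall e, A e -> eps <= z e); last first.
  have /choice[e eP] (k : nat) : exists e, A e /\ (z e : R) < 4^-1 ^+ k.
    apply: contrapT => ne; apply: noeps; exists (4^-1 ^+ k) => [|e Ae].
      by rewrite exprn_gt0 ?invr_gt0 ?ltr0n.
    by rewrite leNgt; apply/negP => ze; apply: ne; exists e.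
  have [|k|b|c c0 cP] := bound e (fun k => 2^-1 ^+ k).
  - by move=> k; case: (eP k).
  - by rewrite exprn_ge0 ?invr_ge0 ?ler0n.
  - by exists 2 => n; exact: (sum_geometric_half_le R (fun k => vabs (e k) <= b)).
  have c2 k : 2 ^+ k <= c.
    have := le_trans (cP k) (ler_wpM2l (ltW c0) (ltW (eP k).2)).
    rewrite -ler_pdivrMr ?exprn_gt0 ?invr_gt0 ?ltr0n // -expr_div_n.
    by have -> : 2^-1 / 4^-1 = 2 :> R by field.
  have : (Num.bound c)%:R <= c.
    apply: le_trans (c2 (Num.bound c)).
    by rewrite -natrX ler_nat; apply: ltnW; exact: ltn_expl.
  by rewrite leNgt => /negP[]; apply: archi_boundP; exact: ltW.
apply: contrapT => /infinite_set_seq[e [einj eA]].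
have [k|b|c c0 cP] := bound e (fun k => k%:R * z (e k)) eA.
- by rewrite mulr_ge0 // ltW // z_gt0.
- have fin := finite_set_order_bounded b eps0 epsz hdisj.
  have pre_fin := finite_preimage (f := e) (in2W einj) fin.
  apply: (@sum_finite_support_bounded R (fun k => vabs (e k) <= b)
    (fun k => k%:R * z (e k))); last first.
    by apply: (sub_finite_set _ pre_fin) => k kb; split.
  by move=> k; rewrite mulr_ge0 // ltW // z_gt0.
have := cP (Num.bound c); rewrite ler_pM2r ?z_gt0 //.
by rewrite leNgt => /negP[]; apply: archi_boundP; exact: ltW.
Qed.
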